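(* If $\tilde A$ is Hurwitz and $A_0\tilde A$ has no negative real eigenvalues, then the origin is globally exponentially stable for the closed-loop system $\dot x=F(x)$.
   Context: Data: $A\in\mathbb{R}^{n\times n}$, $B\in\mathbb{R}^{n\times m}$ with $(A,B)$ stabilizable; $c\in\mathbb{R}^n$, $d\in\mathbb{R}$ with $d>0$; $h(x)=c^\top x+d$. The integer $r\ge 1$ is the relative degree of $h$ for $\dot x=Ax+Bu$: $c^\top A^iB=0$ for $0\le i\le r-2$ and $c^\top A^{r-1}B\neq 0$. $\alpha_1,\dots,\alpha_r>0$ are constants and $\alpha=\prod_{i=1}^r\alpha_i$. $G\in\mathbb{R}^{m\times m}$ is symmetric positive definite. $K\in\mathbb{R}^{m\times n}$ is a nominal gain such that $A_0:=A-BK$ is Hurwitz (all eigenvalues have negative real part). Notation: $\phi(s)=\prod_{j=1}^{r}(s+\alpha_j)$; $\theta=c^\top A^{r-1}B\,G^{-1}B^\top(A^\top)^{r-1}c>0$; $v_1=-\frac{1}{\theta}B\,G^{-1}B^\top(A^\top)^{r-1}c$; $v_2^\top=c^\top(\phi(A)-A^{r-1}BK)$; $\tilde A=A_0+v_1v_2^\top$; $\tilde b=\alpha d\,v_1$; $\eta(x)=v_2^\top x+\alpha d$. Closed-loop system: $\dot x=F(x)$ with $F(x)=A_0x$ if $\eta(x)\ge 0$ and $F(x)=\tilde A x+\tilde b$ if $\eta(x)<0$. It arises from $\dot x=Ax+Bu^*(x)$, where $u^*(x)$ is the safety filter, i.e. the minimizer of $\frac12 (u+Kx)^\top G(u+Kx)$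 over $u\in\mathbb{R}^m$ subject to $c^\top\phi(A)x+c^\top A^{r-1}Bu+\alpha d\ge 0$. Globally exponentially stable: there exist $M,\mu>0$ such that every solution satisfies $\|x(t)\|\le Me^{-\mu t}\|x(0)\|$ for all $t\ge0$. *)

(* Defs.v *)
From mathcomp Require Import all_boot all_order all_algebra.
From mathcomp Require Import complex.
From mathcomp Require Import all_classical all_reals all_analysis.

Set Implicit Arguments.
Unset Strict Implicit.
Unset Printing Implicit Defensive.

Import Order.TTheory GRing.Theory Num.Theory.
Import numFieldNormedType.Exports.
Local Open Scope classical_set_scope.
Local Open Scope ring_scope.

(* Eigenvalues are taken over R[i]; [eigenvalue] uses row eigenvectors, which
   gives the same spectrum as column eigenvectors. *)
Definition hurwitz (R : realType) (n : nat) (A : 'M[R]_n) : Prop :=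
  forall z : R[i], eigenvalue (map_mx (real_complex R) A) z -> complex.Re z < 0.

Definition stabilizable (R : realType) (n m : nat)
    (A : 'M[R]_n) (B : 'M[R]_(n, m)) : Prop :=
  exists K : 'M[R]_(m, n), hurwitz (A - B *m K).

Definition sym_posdef (R : realType) (m : nat) (G : 'M[R]_m) : Prop :=
  G^T = G /\ forall u : 'cV[R]_m, u != 0 -> 0 < (u^T *m G *m u) 0 0.

(* Relative degree of an affine output x |-> c^T x + d for x' = A x + B u;
   it does not depend on d.  The bound [i.+1 < r] is i <= r - 2, written
   without truncated subtraction. *)
Definition has_relative_degree (R : realType) (n m : nat)
    (A : 'M[R]_n) (B : 'M[R]_(n, m)) (c : 'cV[R]_n) (r : nat) : Prop :=
  [/\ (0 < r)%N,
      forall i : nat, (i.+1 < r)%N -> c^T *m A ^+ i *m B = 0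
    & c^T *m A ^+ r.-1 *m B != 0].

Definition phi (R : realType) (r : nat) (alpha : 'I_r -> R) : {poly R} :=
  \prod_(j < r) ('X + (alpha j)%:P).

Definition theta (R : realType) (n m : nat) (A : 'M[R]_n)
    (B : 'M[R]_(n, m)) (c : 'cV[R]_n) (r : nat) (G : 'M[R]_m) : R :=
  (c^T *m A ^+ r.-1 *m B *m invmx G *m B^T *m A^T ^+ r.-1 *m c) 0 0.

Definition v1 (R : realType) (n m : nat) (A : 'M[R]_n)
    (B : 'M[R]_(n, m)) (c : 'cV[R]_n) (r : nat) (G : 'M[R]_m) : 'cV[R]_n :=
  - (theta A B c r G)^-1 *: (B *m invmx G *m B^T *m A^T ^+ r.-1 *m c).

(* The row vector v_2^T.  The state dimension is a successor because
   [horner_mx] requires it. *)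
Definition v2T (R : realType) (n m : nat) (A : 'M[R]_n.+1)
    (B : 'M[R]_(n.+1, m)) (c : 'cV[R]_n.+1) (r : nat) (alpha : 'I_r -> R)
    (K : 'M[R]_(m, n.+1)) : 'rV[R]_n.+1 :=
  c^T *m (horner_mx A (phi alpha) - A ^+ r.-1 *m B *m K).

Definition A0 (R : realType) (n m : nat) (A : 'M[R]_n)
    (B : 'M[R]_(n, m)) (K : 'M[R]_(m, n)) : 'M[R]_n :=
  A - B *m K.

Definition Atilde (R : realType) (n m : nat) (A : 'M[R]_n.+1)
    (B : 'M[R]_(n.+1, m)) (c : 'cV[R]_n.+1) (r : nat) (alpha : 'I_r -> R)
    (G : 'M[R]_m) (K : 'M[R]_(m, n.+1)) : 'M[R]_n.+1 :=
  A0 A B K + v1 A B c r G *m v2T A B c alpha K.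

Definition btilde (R : realType) (n m : nat) (A : 'M[R]_n)
    (B : 'M[R]_(n, m)) (c : 'cV[R]_n) (d : R) (r : nat) (alpha : 'I_r -> R)
    (G : 'M[R]_m) : 'cV[R]_n :=
  ((\prod_(j < r) alpha j) * d) *: v1 A B c r G.

Definition eta (R : realType) (n m : nat) (A : 'M[R]_n.+1)
    (B : 'M[R]_(n.+1, m)) (c : 'cV[R]_n.+1) (d : R) (r : nat)
    (alpha : 'I_r -> R) (K : 'M[R]_(m, n.+1)) (x : 'cV[R]_n.+1) : R :=
  (v2T A B c alpha K *m x) 0 0 + (\prod_(j < r) alpha j) * d.

Definition closed_loop (R : realType) (n m : nat) (A : 'M[R]_n.+1)
    (B : 'M[R]_(n.+1, m)) (c : 'cV[R]_n.+1) (d : R) (r : nat)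
    (alpha : 'I_r -> R) (G : 'M[R]_m) (K : 'M[R]_(m, n.+1))
    (x : 'cV[R]_n.+1) : 'cV[R]_n.+1 :=
  if 0 <= eta A B c d alpha K x then A0 A B K *m x
  else Atilde A B c alpha G K *m x + btilde A B c d alpha G.

(* Classical solutions of x' = F(x) on [0, +oo[: values of [x] at negative
   times are irrelevant. *)
Definition is_solution (R : realType) (n : nat)
    (F : 'cV[R]_n -> 'cV[R]_n) (x : R -> 'cV[R]_n) : Prop :=
  {within `[0, +oo[, continuous x} /\
  forall t : R, 0 < t -> is_derive t 1 x (F (x t)).

(* The library norm on matrices is the sup norm. *)
Definition euclidean_norm (R : realType) (n : nat) (x : 'cV[R]_n) : R :=
  Num.sqrt (\sum_(i < n) x i 0 ^+ 2).

Definition globally_exponentially_stable (R : realType) (n : nat)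
    (F : 'cV[R]_n -> 'cV[R]_n) : Prop :=
  exists M mu : R, [/\ 0 < M, 0 < mu &
    forall x : R -> 'cV[R]_n, is_solution F x ->
    forall t : R, 0 <= t ->
      euclidean_norm (x t) <= M * expR (- mu * t) * euclidean_norm (x 0)].

(* Main.v *)
Require Import Defs.
From HB Require Import structures.
From mathcomp Require Import all_boot all_order all_algebra.
From mathcomp Require Import complex polyrcf ring lra.
From mathcomp Require Import all_classical all_reals all_analysis.

Set Implicit Arguments.
Unset Strict Implicit.
Unset Printing Implicit Defensive.

Import Order.TTheory GRing.Theory Num.Theory.
Import numFieldNormedType.Exports.
Local Open Scope ring_scope.
Local Open Scope sesquilinear_scope.

(** Since the second branch of the vector field is the first one plus
  eta(x) v1, the closed loop is x' = A0 x + w v1 with w = min (eta x) 0: a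
  linear system in feedback with a scalar nonlinearity.  Writing y = v2^T x,
  the positivity of alpha and d gives the sector condition w (y - w) >= 0.
  This is the setting of the circle criterion, and it suffices to find a
  symmetric P and an epsilon > 0 with

    x^T P (A0 x + w v1) <= - epsilon |x|^2   whenever   w (y - w) >= 0,

  such that P is moreover positive definite: then V = x^T P x satisfies
  V' <= - k V along solutions, and V is comparable with |x|^2
  ([sector_feedback_GES]).

  Existence of P is a strict Kalman-Yakubovich-Popov lemma; (A0, v1)
  need not be controllable, so it is proved by convex duality ([strict_kyp]).  The inequality to be achieved is linear in P and in a
  multiplier of w (y - w).  By [psd_alternative], a separation theorem for
  the compact convex set of positive semidefinite matrices of trace one, it
  is solvable unless there is a nonzero semidefinite matrix
  Z = [X, f; f^T, w] with A0 X + v1 f^T skew-symmetric and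
  v2^T f = w.  To exclude such a Z ([kyp_dual]), write f = X k^T, which is
  possible since Z is semidefinite.  Then (A0 + v1 k) X is skew, and by
  [psd_skew_eigenvectors] the matrix X is a sum of x x^* with each x an
  eigenvector of A0 + v1 k for a purely imaginary eigenvalue.  Each x is
  thus a response of the linear system at one frequency, with input
  u = k x, and [frequency_inequality] says that Re (conj u (v2^T x - u)) < 0.
  Summing, v2^T f < k X k^T <= w; if X = 0, then f = 0 < w.

  The frequency inequality amounts to Re g(i omega) < 1 for the transfer
  function g of (A0, v1, v2).  The identity

    det (omega^2 + A0 Atilde) = det (omega^2 + A0^2) (1 - Re g(i omega))

  reduces it to the positivity on [0, +oo[ of two monic real polynomials in
  omega^2.  They have no root there: the first because A0 Atilde has no
  negative eigenvalue and A0, Atilde are invertible, the second because A0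
  has no purely imaginary eigenvalue.

  Finally, P is positive definite because x^T P A0 x < 0 for x <> 0 and A0
  is Hurwitz ([lyapunov_posdef]); in a triangular basis this is an induction
  on the dimension by Schur complements. *)

(** * Hermitian forms and skew pairs over an algebraically closed field *)

Section HermitianForms.
Variable C : numClosedFieldType.
Implicit Types n : nat.

Lemma trmxC_mul m n p (A : 'M[C]_(m, n)) (B : 'M[C]_(n, p)) :
  (A *m B)^t* = B^t* *m A^t*.
Proof. by rewrite trmx_mul map_mxM. Qed.

Lemma trmxCZ m n a (A : 'M[C]_(m, n)) : (a *: A)^t* = a^* *: A^t*.
Proof. by rewrite linearZ map_mxZ. Qed.

Lemma trmxCB m n (A B : 'M[C]_(m, n)) : (A - B)^t* = A^t* - B^t*.
Proof. by rewrite linearB map_mxB. Qed.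

(** A nonzero stable row space contains an eigenvector, because the restriction
    of [g] to it has an eigenvalue. *)
Lemma stable_eigenvector n (X g : 'M[C]_n) : X != 0 -> (X *m g <= X)%MS ->
  exists u : 'rV[C]_n, exists2 l, u *m X != 0 & u *m X *m g = l *: (u *m X).
Proof.
move=> X0 Xg.
have r0 : (0 < \rank X)%N by rewrite lt0n mxrank_eq0.
have [a /eigenvalueP[v va v0]] := eigenvalue_closed (restrictmx X g) r0.
have : (v *m row_base X <= X)%MS by rewrite mulmx_sub // eq_row_base.
case/submxP => u uE; exists u, a; rewrite -uE.
  by rewrite mulmx_free_eq0 ?row_base_free.
have sv : stablemx v (restrictmx X g) by rewrite va scalemx_sub.
rewrite -mulmxA.
have -> : row_base X *m g = restrictmx X g *m row_base X.
  by rewrite /conjmx mulmxKpV // stablemx_row_base.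
by rewrite mulmxA va scalemxAl.
Qed.

Definition hform n (X : 'M[C]_n) (u v : 'rV[C]_n) : C := (u *m X *m v^t*) 0 0.

Lemma hformDl n (X : 'M[C]_n) u v w : hform X (u + v) w = hform X u w + hform X v w.
Proof. by rewrite /hform !mulmxDl mxE. Qed.

Lemma hformZl n (X : 'M[C]_n) a u w : hform X (a *: u) w = a * hform X u w.
Proof. by rewrite /hform -!scalemxAl mxE. Qed.

Lemma hform_conj n (X : 'M[C]_n) u v : X^t* = X -> hform X u v = (hform X v u)^*.
Proof.
move=> Xh; rewrite /hform -[in LHS]Xh.
have -> : u *m X^t* *m v^t* = (v *m X *m u^t*)^t*.
  by rewrite !trmxC_mul trmxCK mulmxA.
by rewrite !mxE.
Qed.

Lemma hformB_expand n (X : 'M[C]_n) a (u v : 'rV_n) : X^t* = X ->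
  hform X (v - a *: u) (v - a *: u) =
  hform X v v - a^* * hform X v u - a * hform X u v + a * a^* * hform X u u.
Proof.
move=> Xh; rewrite -scaleNr.
rewrite hformDl hformZl (hform_conj v _ Xh) (hform_conj u (_ + _) Xh).
rewrite !hformDl !hformZl !rmorphD !rmorphM !rmorphN /= -!(hform_conj _ _ Xh).
by ring.
Qed.

Lemma hform1E n (y : 'rV[C]_n) : hform 1%:M y y = \sum_i `|y 0 i| ^+ 2.
Proof.
by rewrite /hform mulmx1 mxE; apply: eq_bigr => i _; rewrite !mxE -normCK.
Qed.

Lemma hform1_ge0 n (y : 'rV[C]_n) : 0 <= hform 1%:M y y.
Proof. by rewrite hform1E sumr_ge0 // => i _; rewrite exprn_ge0. Qed.

Lemma hform1_eq0 n (y : 'rV[C]_n) : hform 1%:M y y = 0 -> y = 0.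
Proof.
rewrite hform1E => /eqP; rewrite psumr_eq0 => [/allP y0|i _]; last exact: exprn_ge0.
apply/rowP => i; have := y0 i (mem_index_enum i).
by rewrite /= expf_eq0 /= normr_eq0 mxE => /eqP.
Qed.

(** Minimizing the form at [u - a y] over [a], for [y = u X], shows that [y]
    vanishes when the form does at [u]. *)
Lemma psd_hform_eq0 n (X : 'M[C]_n) (u : 'rV_n) :
  X^t* = X -> (forall v, 0 <= hform X v v) ->
  hform X u u = 0 -> u *m X = 0.
Proof.
move=> Xh Xp u0; set y := u *m X; set c := hform 1%:M y y.
have yy : hform X u y = c by rewrite /c /hform mulmx1.
have c0 : 0 <= c by apply: hform1_ge0.
have cR : c^* = c by apply/CrealP; rewrite ger0_real.
have q0 := Xp y; set q := hform X y y in q0.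
(* The minimizer would be [c / q]; adding one avoids the case [q = 0]. *)
pose a := c / (q + 1).
have q1 : 0 < q + 1 by rewrite ltr_wpDl.
have aR : a^* = a by apply/CrealP; rewrite ger0_real // divr_ge0 // ltW.
have := Xp (u - a *: y); rewrite hformB_expand // u0 (hform_conj y u Xh) // yy cR aR -/q.
have -> : 0 - a * c - a * c + a * a * q = - (a * c * ((q + 2) / (q + 1))).
  by rewrite /a; field; rewrite gt_eqF.
rewrite oppr_ge0 pmulr_lle0; last by rewrite divr_gt0 // ltr_wpDl.
rewrite /a mulrAC pmulr_lle0 ?invr_gt0 // => cle.
apply: hform1_eq0; rewrite -/c; apply/eqP.
have : c * c == 0 by rewrite eq_le cle mulr_ge0.
by rewrite mulf_eq0 orbb.
Qed.

Lemma hform_real n (P : 'M[C]_n) (v : 'rV_n) : P^t* = P -> hform P v v \is Num.real.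
Proof. by move=> Ph; apply/CrealP; rewrite -(hform_conj v v Ph). Qed.

Lemma hform_mul m n (P : 'M[C]_n) (J : 'M[C]_(m, n)) u v :
  hform P (u *m J) (v *m J) = hform (J *m P *m J^t*) u v.
Proof. by rewrite /hform trmxC_mul !mulmxA. Qed.

Lemma hform_eigenvector n (P T : 'M[C]_n) (v : 'rV_n) a : v *m T = a *: v ->
  hform (T *m P) v v = a * hform P v v.
Proof. by move=> vT; rewrite /hform mulmxA vT -!scalemxAl mxE. Qed.

(** The row space of [X] is stable under [g], so it contains an eigenvector
    [x = u X] of [g]; testing the skewness of [X g] against [u] shows that its
    eigenvalue is purely imaginary.  With [s = u X u^*], subtracting
    [s^-1 x^* x] keeps all the hypotheses (positivity is the Cauchy-Schwarz
    inequality for [X]) and lowers the rank, whence the induction. *)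
Lemma psd_skew_eigenvectors n (X g : 'M[C]_n) :
  X^t* = X -> (forall u : 'rV_n, 0 <= hform X u u) ->
  X *m g + g^t* *m X = 0 ->
  exists2 s : seq 'rV[C]_n, X = \sum_(x <- s) x^t* *m x &
    forall x, x \in s ->
      x != 0 /\ exists2 l, 'Re l = 0 & x *m g = l *: x.
Proof.
have [k] := ubnP (\rank X); elim: k X => // k IH X.
rewrite ltnS => rk Xh Xp Xg.
have [X0|X0] := eqVneq X 0; first by exists [::]; rewrite ?big_nil.
have XgE : X *m g = - (g^t* *m X) by apply/eqP; rewrite -addr_eq0 Xg.
have stab : (X *m g <= X)%MS by rewrite XgE eqmx_opp submxMl.
have [u [l ux0 ul]] := stable_eigenvector X0 stab.
move xdef: (u *m X) ux0 ul => x ux0 ul.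
have xE : x^t* = X *m u^t* by rewrite -xdef trmxC_mul Xh.
set s := hform X u u.
have s0 : 0 < s.
  rewrite lt_def Xp andbT; apply/eqP => s0.
  by case/eqP: ux0; rewrite -xdef; apply: psd_hform_eq0.
have sR : s^* = s by apply/CrealP; rewrite gtr0_real.
have xu : x *m u^t* = s%:M by rewrite -xdef [LHS]mx11_scalar.
have lE : 'Re l = 0.
  have : u *m (X *m g + g^t* *m X) *m u^t* = 0 by rewrite Xg mulmx0 mul0mx.
  rewrite mulmxDr mulmxDl !mulmxA xdef ul -scalemxAl xu.
  have -> : u *m g^t* *m X *m u^t* = (x *m g *m u^t*)^t*.
    by rewrite !trmxC_mul xE trmxCK !mulmxA.
  rewrite ul -scalemxAl xu => /matrixP/(_ 0 0).
  rewrite !mxE /= mulr1n rmorphM /= sR -mulrDl => /eqP.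
  rewrite mulf_eq0 (gt_eqF s0) orbF => /eqP.
  by move=> h; rewrite ReE h mul0r.
have lC : l^* = - l.
  apply/eqP; rewrite -addr_eq0 addrC; move/eqP: lE.
  by rewrite ReE mulf_eq0 invr_eq0 pnatr_eq0 orbF.
pose X' := X - s^-1 *: (x^t* *m x).
have sVR : (s^-1)^* = s^-1 by rewrite fmorphV /= sR.
have X'h : X'^t* = X'.
  by rewrite /X' trmxCB trmxCZ sVR trmxC_mul trmxCK Xh.
have X'u : X' *m u^t* = 0.
  rewrite /X' mulmxBl -scalemxAl -mulmxA xu mul_mx_scalar scalerA mulVf ?gt_eqF //.
  by rewrite scale1r xE subrr.
have X'v v : hform X' v v = hform X v v - s^-1 * (hform X v u * hform X u v).
  rewrite /X' {1}/hform mulmxBr mulmxBl mxE -/(hform X v v) mxE.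
  rewrite -scalemxAr -scalemxAl mxE !mulmxA xE.
  rewrite (mulmxA v X) -(mulmxA _ x) (mx11_scalar (v *m X *m _)).
  by rewrite mul_scalar_mx mxE -xdef.
have X'p v : 0 <= hform X' v v.
  have := Xp (v - (hform X v u / s) *: u); rewrite hformB_expand // -/s X'v.
  rewrite rmorphM /= sVR -(hform_conj u v Xh).
  by congr (_ <= _); field; rewrite gt_eqF.
have X'g : X' *m g + g^t* *m X' = 0.
  rewrite /X' mulmxBl mulmxBr -scalemxAl -scalemxAr addrACA Xg add0r.
  rewrite -opprD -scalerDr -mulmxA ul -scalemxAr mulmxA.
  have -> : g^t* *m x^t* = (- l) *: x^t* by rewrite -trmxC_mul ul trmxCZ lC.
  by rewrite -scalemxAl scaleNr subrr scaler0 oppr0.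
(* [X'] kills [u^*], whereas [x u^*] is nonzero for [x] in the row space of [X]. *)
have rk' : (\rank X' < k)%N.
  apply: leq_trans rk; apply: rank_ltmx; apply/andP; split.
    by rewrite /X' addmx_sub ?submx_refl // eqmx_opp scalemx_sub // -xdef mulmxA submxMl.
  apply/negP => /(submx_trans (submxMl u X)) /submxP[w wE].
  move: s0; rewrite /s /hform wE -mulmxA X'u mulmx0 mxE ltxx //.
have [t tE tP] := IH X' rk' X'h X'p X'g.
pose a := (sqrtC s)^-1.
have aR : a^* = a by apply/CrealP; rewrite ger0_real // invr_ge0 sqrtC_ge0 ltW.
have aa : a * a = s^-1 by rewrite /a -invfM -expr2 sqrtCK.
exists ((a *: x) :: t) => [|y].
  rewrite big_cons -tE trmxCZ aR -scalemxAl -scalemxAr scalerA aa.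
  by rewrite /X' addrC subrK.
rewrite inE => /orP[/eqP->|/tP //]; split.
  by rewrite scaler_eq0 negb_or ux0 andbT invr_eq0 sqrtC_eq0 gt_eqF.
by exists l => //; rewrite -scalemxAl ul scalerA mulrC -scalerA.
Qed.

(** For lower triangular [T], the first basis vector [e] is an eigenvector,
    which gives the positivity of [P] at [e].  The rows of [J] span the
    [P]-orthogonal complement of [e]; there [T] acts, modulo [e], as its lower
    right block, so that the induction hypothesis applies to [J P J^*], the
    Schur complement of [P]. *)
Lemma trig_lyapunov_posdef n (T P : 'M[C]_n) : is_trig_mx T ->
  (forall i, 'Re (T i i) < 0) -> P^t* = P ->
  (forall v : 'rV_n, v != 0 -> 'Re (hform (T *m P) v v) < 0) ->
  forall v : 'rV_n, v != 0 -> 0 < hform P v v.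
Proof.
move=> Ttrig; elim/trigsqmx_ind: {n T} _ / Ttrig P
  => [P _ _ _ v|n x c T Ttrig IH P Tneg Ph Plyap].
  by rewrite thinmx0 eqxx.
set TT := block_mx x 0 c T in Tneg Plyap.
pose e : 'rV[C]_(1 + n) := row_mx 1 0.
have e0 : e != 0 by rewrite row_mx_eq0 oner_eq0.
have eT : e *m TT = x 0 0 *: e.
  rewrite /e mul_row_block !mul1mx !mul0mx !addr0 scale_row_mx scaler0.
  by rewrite {1}[x]mx11_scalar scalemx1.
have pR := hform_real e Ph; set p := hform P e e in pR.
have p0 : 0 < p.
  have := Plyap e e0; rewrite (hform_eigenvector _ eT) -/p ReMr // => h.
  have x0 : 'Re (x 0 0) < 0.
    by have := Tneg (lshift n 0); rewrite /TT block_mxEul.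
  by rewrite -(nmulr_rlt0 _ x0).
have eE : e *m P *m e^t* = p%:M by rewrite [LHS]mx11_scalar.
pose I1 : 'M[C]_(n, 1 + n) := row_mx 0 1%:M.
pose q := I1 *m P *m e^t*.
pose J := I1 - p^-1 *: (q *m e).
have JPe : J *m P *m e^t* = 0.
  rewrite /J !mulmxBl -/q -!scalemxAl -!(mulmxA q) eE mul_mx_scalar.
  by rewrite scalerA mulVf ?gt_eqF // scale1r subrr.
have ePJ : e *m P *m J^t* = 0.
  have := congr1 (fun M => M^t*) JPe.
  by rewrite /= !trmxC_mul trmxCK Ph trmx0 map_mx0 mulmxA.
have [k JT] : exists k, J *m TT = T *m J + k *m e.
  exists (c - p^-1 *: (x 0 0 *: q) + p^-1 *: (T *m q)).
  have I1T : I1 *m TT = c *m e + T *m I1.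
    rewrite /I1 /TT /e mul_row_block !mul0mx !mul1mx !add0r !mul_mx_row.
    by rewrite !mulmx1 !mulmx0 add_row_mx addr0 add0r.
  rewrite /J mulmxBl mulmxBr I1T -!scalemxAl -!scalemxAr -mulmxA eT.
  rewrite !mulmxDl mulNmx -!scalemxAl -scalemxAr mulmxA.
  by rewrite [RHS]addrACA addNr addr0 addrA (addrC (T *m I1)).
have P'h : (J *m P *m J^t*)^t* = J *m P *m J^t*.
  by rewrite !trmxC_mul trmxCK Ph mulmxA.
have vJ0 (v : 'rV_n) : v != 0 -> v *m J != 0.
  apply: contra_neq; rewrite /J mulmxBr mul_mx_row mulmx0 mulmx1 -scalemxAr.
  rewrite mulmxA mul_mx_row mulmx0 scale_row_mx scaler0 opp_row_mx add_row_mx.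
  by rewrite oppr0 addr0 => /eqP; rewrite row_mx_eq0 => /andP[_ /eqP].
have Tneg' i : 'Re (T i i) < 0.
  by have := Tneg (rshift 1 i); rewrite /TT block_mxEdr.
have P'pos : forall v : 'rV_n, v != 0 -> 0 < hform (J *m P *m J^t*) v v.
  apply: IH => // v v0; have := Plyap _ (vJ0 v v0); rewrite hform_mul.
  congr ('Re (hform _ v v) < 0).
  by rewrite !mulmxA JT !mulmxDl -!(mulmxA k) ePJ mulmx0 addr0.
move=> w w0.
pose v := rsubmx w.
pose s := lsubmx w + p^-1 *: (v *m q).
have sE : s *m e = s 0 0 *: e by rewrite [s in LHS]mx11_scalar mul_scalar_mx.
have wE : w = v *m J - (- s 0 0) *: e.
  rewrite scaleNr opprK -sE /J mulmxBr -scalemxAr mulmxA /s mulmxDl -scalemxAl.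
  rewrite addrA -addrA addrACA addNr addr0 /I1 /e !mul_mx_row !mulmx0 !mulmx1.
  by rewrite add_row_mx add0r addr0 hsubmxK.
have vJe : hform P (v *m J) e = 0.
  by rewrite /hform -!mulmxA (mulmxA J) JPe mulmx0 mxE.
rewrite wE hformB_expand // (hform_conj e _ Ph) vJe conjC0 !mulr0 !subr0 -/p.
have [v0|v0] := eqVneq v 0; last first.
  by rewrite ltr_wpDr ?hform_mul ?P'pos // mulr_ge0 ?mul_conjC_ge0 // ltW.
have sn0 : - s 0 0 != 0.
  rewrite oppr_eq0; apply: contra_neq w0 => s0.
  by rewrite wE v0 s0 mul0mx oppr0 scale0r subr0.
rewrite ltr_wpDl //; first by rewrite v0 mul0mx /hform !mul0mx mxE.
by rewrite pmulr_lgt0 // mul_conjC_gt0.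
Qed.

(** Schur triangularization by a unitary [U] replaces [T] by [U T U^*] and [P] by
    [U P U^*], which leads to the triangular case. *)
Lemma lyapunov_posdef n (T P : 'M[C]_n) :
  (forall a, eigenvalue T a -> 'Re a < 0) -> P^t* = P ->
  (forall v : 'rV_n, v != 0 -> 'Re (hform (T *m P) v v) < 0) ->
  forall v : 'rV_n, v != 0 -> 0 < hform P v v.
Proof.
case: n T P => [|n] T P Tneg Ph Plyap v v0; first by rewrite thinmx0 eqxx in v0.
have [U Uu] := Schur T (ltn0Sn n); rewrite /similar_to /= conjymx // => Ttrig.
have UU' : U *m U^t* = 1%:M by apply/unitarymxP.
have UU := mulmx1C UU'.
set T' := U *m T *m U^t* in Ttrig.
have T'U : T' *m U = U *m T by rewrite /T' -mulmxA UU mulmx1.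
have inj (w : 'rV_n.+1) : w != 0 -> w *m U != 0.
  by apply: contra_neq => w0; rewrite -[w]mulmx1 -UU' mulmxA w0 mul0mx.
have T'neg i : 'Re (T' i i) < 0.
  apply: Tneg; have : eigenvalue T' (T' i i).
    rewrite eigenvalue_root_char char_poly_trig //.
    apply/rootP; rewrite horner_prod (bigD1 i) //=; apply/eqP.
    by rewrite mulf_eq0 !hornerE subrr eqxx.
  case/eigenvalueP => w wT w0; apply/eigenvalueP; exists (w *m U); last exact: inj.
  by rewrite -mulmxA -T'U mulmxA wT scalemxAl.
have := @trig_lyapunov_posdef _ T' (U *m P *m U^t*) Ttrig T'neg.
have -> : v = v *m U^t* *m U by rewrite -mulmxA UU mulmx1.
rewrite hform_mul; apply.
- by rewrite !trmxC_mul trmxCK Ph mulmxA.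
- move=> w w0; have := Plyap _ (inj w w0); rewrite hform_mul.
  congr ('Re (hform _ w w) < 0).
  by rewrite !mulmxA T'U.
apply: contra_neq v0 => v0.
by rewrite -[v]mulmx1 -UU mulmxA v0 mul0mx.
Qed.

End HermitianForms.

(** * Determinants, eigenvalues and roots *)

(** Both sides compute the determinant of the block matrix [1, v; p, 1] by block
    elimination, in the two possible orders. *)
Lemma det_sub_rank_one (R : comNzRingType) n (p : 'cV[R]_n) (v : 'rV[R]_n) :
  \det (1%:M - p *m v) = 1 - (v *m p) 0 0.
Proof.
have E1 : block_mx (1%:M : 'M[R]_1) v p 1%:M =
   block_mx 1%:M 0 p 1%:M *m block_mx 1%:M v 0 (1%:M - p *m v).
  rewrite mulmx_block !(mul1mx, mulmx1, mul0mx, mulmx0) !addr0.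
  by congr block_mx; rewrite addrC subrK.
have E2 : block_mx (1%:M : 'M[R]_1) v p 1%:M =
   block_mx (1%:M - v *m p) v 0 1%:M *m block_mx 1%:M 0 p 1%:M.
  rewrite mulmx_block !(mul1mx, mulmx1, mul0mx, mulmx0) !add0r.
  by congr block_mx; rewrite subrK.
move: (congr1 determinant E1); rewrite E2 !det_mulmx !det_lblock !det_ublock.
rewrite !det1 !mulr1 !mul1r.
by move=> <-; rewrite det_mx11 !mxE.
Qed.

Lemma horner_char_polyE (R : comNzRingType) n (M : 'M[R]_n) a :
  (char_poly M).[a] = \det (a%:M - M).
Proof.
rewrite -horner_evalE -det_map_mx; congr (\det _); apply/matrixP => i j.
by rewrite !mxE /= /horner_eval !(hornerE, hornerMn).
Qed.

Lemma det_eigenvalue (F : fieldType) n (M : 'M[F]_n) a :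
  (\det (a%:M - M) == 0) = eigenvalue M a.
Proof. by rewrite -horner_char_polyE eigenvalue_root_char. Qed.

(** As a function of [l] the determinant is a monic polynomial, hence positive near
    infinity; having no root on [0, +oo[, it keeps its sign. *)
Lemma det_shift_gt0 (R : rcfType) n (M : 'M[R]_n) :
  (forall l, 0 <= l -> \det (l%:M + M) != 0) ->
  forall l, 0 <= l -> 0 < \det (l%:M + M).
Proof.
move=> dn l l0; rewrite -[M]opprK -horner_char_polyE.
have nr : {in `[0, +oo[, forall x, ~~ root (char_poly (- M)) x}.
  move=> x; rewrite in_itv /= andbT => x0.
  by rewrite rootE horner_char_polyE opprK dn.
rewrite -sgr_gt0 (sgp_pinftyP nr) ?in_itv /= ?l0 //.
by rewrite /sgp_pinfty (monicP (char_poly_monic _)) sgr1.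
Qed.

(** * Real quadratic forms and their complexification *)

Section RealForms.
Variable R : realType.
Implicit Types n : nat.
Local Notation toC := (map_mx (real_complex R)).

Lemma Re_conj_mul_lt0 (w y : R[i]) : w != 0 -> complex.Re y < 1 ->
  complex.Re (w^* * (w * y - w)) < 0.
Proof.
move=> w0 y1; have -> : w^* * (w * y - w) = w^* * w * (y - 1) by ring.
have : 0 < w^* * w by rewrite mulrC mul_conjC_gt0.
case: (w^* * w) => a c; rewrite ltcE /= => /andP[/eqP -> a0].
case: y y1 => y z /= y1; rewrite mul0r subr0.
by rewrite pmulr_rlt0 // subr_lt0.
Qed.

Lemma map_Re_mul n m (M : 'M[R]_(m, n)) (x : 'cV[R[i]]_n) :
  map_mx (@complex.Re R) (toC M *m x) = M *m map_mx (@complex.Re R) x.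
Proof.
apply/matrixP => i j; rewrite !mxE raddf_sum; apply: eq_bigr => l _.
by rewrite !mxE; case: (x l j) => a b /=; rewrite mul0r subr0.
Qed.

Lemma map_Im_mul n m (M : 'M[R]_(m, n)) (x : 'cV[R[i]]_n) :
  map_mx (@complex.Im R) (toC M *m x) = M *m map_mx (@complex.Im R) x.
Proof.
apply/matrixP => i j; rewrite !mxE raddf_sum; apply: eq_bigr => l _.
by rewrite !mxE; case: (x l j) => a b /=; rewrite mul0r addr0.
Qed.

Definition qform n (M : 'M[R]_n) (u : 'rV[R]_n) : R := (u *m M *m u^T) 0 0.

Definition psd n (M : 'M[R]_n) : Prop :=
  M^T = M /\ forall u : 'rV[R]_n, 0 <= qform M u.

Lemma toC_trmxC m n (M : 'M[R]_(m, n)) : (toC M)^t* = toC M^T.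
Proof.
apply/matrixP => i j; rewrite !mxE; apply/eqP.
by rewrite eq_complex /= oppr0 !eqxx.
Qed.

Lemma Re_hform n (M : 'M[R]_n) (v : 'rV[R[i]]_n) :
  complex.Re (hform (toC M) v v) =
  qform M (map_mx (@complex.Re R) v) + qform M (map_mx (@complex.Im R) v).
Proof.
set p := map_mx _ v; set q := map_mx (@complex.Im R) v.
have vE : v = toC p + Complex 0 1 *: toC q.
  apply/matrixP => i j; rewrite !mxE; apply/eqP; rewrite eq_complex.
  by case: (v i j) => a c /=; apply/andP; split; apply/eqP; ring.
have hE (a c : 'rV[R]_n) :
    hform (toC M) (toC a) (toC c) = ((a *m M *m c^T) 0 0)%:C%C.
  by rewrite /hform toC_trmxC -!map_mxM mxE.
have Zr a c w : hform (toC M) c (a *: w) = a^* * hform (toC M) c w.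
  by rewrite /hform linearZ map_mxZ -scalemxAr mxE.
have Dr a c w : hform (toC M) c (a + w) = hform (toC M) c a + hform (toC M) c w.
  by rewrite /hform linearD map_mxD mulmxDr mxE.
rewrite vE !Dr !hformDl !Zr !hformZl !hE /= -/(qform M p) -/(qform M q).
ring.
Qed.

Lemma psd_toC n (M : 'M[R]_n) (v : 'rV[R[i]]_n) : psd M -> 0 <= hform (toC M) v v.
Proof.
move=> [Ms Mp]; have Mh : (toC M)^t* = toC M by rewrite toC_trmxC Ms.
have := hform_real v Mh; move/RRe_real => <-.
by rewrite lecR Re_hform addr_ge0.
Qed.

Lemma qformZ n (M : 'M[R]_n) a u : qform M (a *: u) = a ^+ 2 * qform M u.
Proof. by rewrite /qform linearZ -!scalemxAl -scalemxAr !mxE; ring. Qed.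

Lemma linear_coef_eq0 (a w : R) : 0 <= w ->
  (forall s, 0 <= a * s *+ 2 + s ^+ 2 * w) -> a = 0.
Proof.
move=> w0 /(_ (- a / (w + 1))).
have -> : a * (- a / (w + 1)) *+ 2 + (- a / (w + 1)) ^+ 2 * w =
  - (a ^+ 2 * ((w + 2) / (w + 1) ^+ 2)) by field; lra.
rewrite oppr_ge0 pmulr_lle0; last by rewrite divr_gt0 ?exprn_gt0 //; lra.
by move=> h; apply/eqP; rewrite -sqrf_eq0 eq_le h sqr_ge0.
Qed.

Section BlockPsd.
Variables (n : nat) (X : 'M[R]_n) (f : 'cV[R]_n) (w : R).
Hypothesis Zpsd : psd (block_mx X f f^T w%:M).

Lemma qform_block (u : 'rV[R]_n) (s : R) :
  qform (block_mx X f f^T w%:M) (row_mx u s%:M) =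
  qform X u + (u *m f) 0 0 * s *+ 2 + s ^+ 2 * w.
Proof.
have entD (A B : 'M[R]_1) : (A + B) 0 0 = A 0 0 + B 0 0 by rewrite mxE.
have entZ a (A : 'M[R]_1) : (a *: A) 0 0 = a * A 0 0 by rewrite mxE.
have fu : (f^T *m u^T) 0 0 = (u *m f) 0 0 by rewrite -trmx_mul mxE.
rewrite /qform mul_row_block tr_row_mx mul_row_col tr_scalar_mx mul_mx_scalar.
rewrite !mulmxDl !mul_scalar_mx -!scalemxAl !(entD, entZ) fu [w%:M 0 0]mxE /=.
by rewrite mulr1n; ring.
Qed.

Lemma block_psd_ul : psd X.
Proof.
case: Zpsd => Zs Zp; split.
  by move: Zs; rewrite tr_block_mx => /eq_block_mx[].
move=> u; have := Zp (row_mx u 0%:M); rewrite qform_block.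
by rewrite mulr0 mul0rn expr0n mul0r !addr0.
Qed.

(** A vector killed by [X] is isotropic for the block matrix, hence also
    orthogonal to [f]; so [f] lies in the column space of [X]. *)
Lemma block_psd_range : exists k : 'rV[R]_n, f^T = k *m X.
Proof.
have [Xs Xp] := block_psd_ul; case: Zpsd => Zs Zp.
apply/submxP; rewrite submxE; apply/eqP.
apply: (can_inj (@trmxK R 1 n)); rewrite trmx_mul trmxK trmx0.
have cX : (cokermx X)^T *m X = 0 by rewrite -{2}Xs -trmx_mul mulmx_coker trmx0.
apply/row_matrixP => i; rewrite row_mul row0.
set u := row i _.
have uX : u *m X = 0 by rewrite -row_mul cX row0.
have pos s : 0 <= (u *m f) 0 0 * s *+ 2 + s ^+ 2 * w.
  by have := Zp (row_mx u s%:M); rewrite qform_block {1}/qform uX mul0mx mxE add0r.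
apply/matrixP => j l; rewrite !ord1 [RHS]mxE.
apply: linear_coef_eq0 pos; have := Zp (row_mx 0 1%:M).
by rewrite qform_block {1}/qform !mul0mx !mxE !mul0r mul0rn !add0r expr1n mul1r.
Qed.

(** The Schur complement of [X] is nonnegative: evaluate the form at
    [(- k, 1)]. *)
Lemma block_psd_schur (k : 'rV[R]_n) : f^T = k *m X -> qform X k <= w.
Proof.
move=> fk; case: Zpsd => Zs Zp; have := Zp (row_mx (- k) 1%:M).
have fE : f = X *m k^T.
  by rewrite -[f]trmxK fk trmx_mul (block_psd_ul).1.
rewrite qform_block -scaleN1r qformZ -scalemxAl [X in _ + X * _ *+ _]mxE fE.
by rewrite mulmxA -/(qform X k); lra.
Qed.
End BlockPsd.

Lemma psd_outer N (u : 'rV[R]_N) : psd (u^T *m u).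
Proof.
split; first by rewrite trmx_mul trmxK.
move=> v; rewrite /qform mulmxA -mulmxA -[u in X in _ <= X]trmxK -trmx_mul.
by rewrite trmxK mxE big_ord1 [X in _ * X]mxE -expr2 sqr_ge0.
Qed.

Lemma psdD N (Y Z : 'M[R]_N) : psd Y -> psd Z -> psd (Y + Z).
Proof.
move=> [Ys Yp] [Zs Zp]; split; first by rewrite linearD /= Ys Zs.
by move=> u; rewrite /qform mulmxDr mulmxDl mxE addr_ge0 ?Yp ?Zp.
Qed.

Lemma psdZ N a (Z : 'M[R]_N) : 0 <= a -> psd Z -> psd (a *: Z).
Proof.
move=> a0 [Zs Zp]; split; first by rewrite linearZ /= Zs.
by move=> u; rewrite /qform -scalemxAr -scalemxAl mxE mulr_ge0 ?Zp.
Qed.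

Lemma psd_diag_ge0 N (Z : 'M[R]_N) i : psd Z -> 0 <= Z i i.
Proof.
move=> [_ /(_ (delta_mx 0 i))]; rewrite /qform -rowE trmx_delta.
by rewrite -colE !mxE.
Qed.

(** The form is nonnegative at [e_i + e_j] and at [e_i - e_j]. *)
Lemma psd_entry_le N (Z : 'M[R]_N) i j : psd Z -> `|Z i j| <= \tr Z.
Proof.
move=> Zp; have [Zs Zq] := Zp.
have sym : Z j i = Z i j by rewrite -[in LHS]Zs mxE.
have tr2 : Z i i + Z j j <= \tr Z *+ 2.
  have le1 l : Z l l <= \tr Z.
    by rewrite /mxtrace (bigD1 l) //= lerDl sumr_ge0 // => a _; apply: psd_diag_ge0.
  by rewrite mulr2n lerD.
have E (s : R) : qform Z (delta_mx 0 i + s *: delta_mx 0 j) =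
    Z i i + s * Z i j *+ 2 + s ^+ 2 * Z j j.
  rewrite /qform linearD linearZ /= !trmx_delta !mulmxDl !mulmxDr.
  rewrite -!scalemxAl -!scalemxAr -!rowE -!colE !mxE sym; ring.
have := Zq (delta_mx 0 i + 1 *: delta_mx 0 j).
have := Zq (delta_mx 0 i + (- 1) *: delta_mx 0 j).
rewrite !E ler_norml => h1 h2; apply/andP; split; clear -h1 h2 tr2; lra.
Qed.

Definition frob m n (A B : 'M[R]_(m, n)) : R := \sum_i \sum_j A i j * B i j.

Lemma frobE m n (A B : 'M[R]_(m, n)) : frob A B = \tr (A^T *m B).
Proof.
rewrite /frob exchange_big /=; apply: eq_bigr => j _; rewrite mxE.
by apply: eq_bigr => i _; rewrite mxE.
Qed.

Lemma frobC m n (A B : 'M[R]_(m, n)) : frob A B = frob B A.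
Proof. by apply: eq_bigr => i _; apply: eq_bigr => j _; rewrite mulrC. Qed.

Lemma frobDl m n (A B D : 'M[R]_(m, n)) : frob (A + B) D = frob A D + frob B D.
Proof. by rewrite !frobE linearD mulmxDl linearD. Qed.

Lemma frobZl m n a (A D : 'M[R]_(m, n)) : frob (a *: A) D = a * frob A D.
Proof. by rewrite !frobE linearZ -scalemxAl linearZ. Qed.

Lemma frob_ge0 m n (A : 'M[R]_(m, n)) : 0 <= frob A A.
Proof. by do 2!apply: sumr_ge0 => ? _; rewrite -expr2 sqr_ge0. Qed.

Lemma frob_gt0 m n (A : 'M[R]_(m, n)) : A != 0 -> 0 < frob A A.
Proof.
move=> A0; rewrite lt_def frob_ge0 andbT; apply: contra A0.
have sq i j : 0 <= A i j * A i j by rewrite -expr2 sqr_ge0.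
have sqs i : 0 <= \sum_j A i j * A i j by apply: sumr_ge0.
rewrite psumr_eq0 // => /allP h; apply/eqP/matrixP => i j; rewrite mxE.
have := h i (mem_index_enum i); rewrite /= psumr_eq0 // => /allP h'.
by have := h' j (mem_index_enum j); rewrite /= -expr2 sqrf_eq0 => /eqP.
Qed.

Lemma trace_outer N (u : 'rV[R]_N) : \tr (u^T *m u) = (u *m u^T) 0 0.
Proof. by rewrite mxtrace_mulC /mxtrace big_ord1. Qed.

Lemma row_norm_ge0 n (u : 'rV[R]_n) : 0 <= (u *m u^T) 0 0.
Proof. by rewrite -trace_outer -frobE frob_ge0. Qed.

Lemma row_norm_gt0 n (u : 'rV[R]_n) : u != 0 -> 0 < (u *m u^T) 0 0.
Proof. by move=> u0; rewrite -trace_outer -frobE frob_gt0. Qed.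

Lemma qform_bound n (M : 'M[R]_n) : exists2 c, 0 < c &
  forall u, `|qform M u| <= c * (u *m u^T) 0 0.
Proof.
exists (1 + \sum_i \sum_j `|M i j|).
  by rewrite ltr_wpDr // sumr_ge0 // => i _; apply: sumr_ge0.
move=> u; set s := (u *m u^T) 0 0.
have sE : s = \sum_j u 0 j ^+ 2.
  by rewrite /s mxE; apply: eq_bigr => j _; rewrite mxE expr2.
have s0 : 0 <= s by rewrite sE sumr_ge0 // => j _; rewrite sqr_ge0.
have ule i : u 0 i ^+ 2 <= s.
  by rewrite sE (bigD1 i) //= lerDl sumr_ge0 // => j _; rewrite sqr_ge0.
have uu i j : `|u 0 i * u 0 j| <= s.
  have := ule i; have := ule j.
  have := sqr_ge0 (u 0 i - u 0 j); have := sqr_ge0 (u 0 i + u 0 j).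
  rewrite !expr2 ler_norml => h1 h2 h3 h4.
  by apply/andP; split; clear -h1 h2 h3 h4; lra.
have -> : qform M u = \sum_j \sum_i M i j * (u 0 i * u 0 j).
  rewrite /qform mxE; apply: eq_bigr => j _; rewrite !mxE mulr_suml.
  by apply: eq_bigr => i _; rewrite mulrCA mulrA.
rewrite mulrDl mul1r ler_wpDl // exchange_big mulr_suml.
apply: le_trans (ler_norm_sum _ _ _) _; apply: ler_sum => i _.
rewrite mulr_suml; apply: le_trans (ler_norm_sum _ _ _) _; apply: ler_sum => j _.
by rewrite normrM ler_wpM2l.
Qed.

Lemma hurwitz_tr n (A : 'M[R]_n) : hurwitz A -> hurwitz A^T.
Proof.
move=> Ah z; rewrite -map_trmx -det_eigenvalue -det_tr.
by rewrite linearB /= tr_scalar_mx trmxK det_eigenvalue => /Ah.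
Qed.

Lemma hurwitz_det_neq0 n (M : 'M[R]_n) : hurwitz M -> \det M != 0.
Proof.
move=> Mh; apply/negP => M0.
have : eigenvalue M 0.
  by rewrite -det_eigenvalue raddf0 sub0r -scaleN1r detZ mulf_eq0 M0 orbT.
rewrite -(eigenvalue_map (real_complex R)) => /Mh /=.
by rewrite ltxx.
Qed.

(** The real form of [lyapunov_posdef], with [P A] in place of its transpose. *)
Lemma hurwitz_lyapunov_posdef n (A P : 'M[R]_n) : hurwitz A -> P^T = P ->
  (forall u : 'rV_n, u != 0 -> qform (P *m A) u < 0) ->
  forall u : 'rV_n, u != 0 -> 0 < qform P u.
Proof.
move=> Ah Ps neg u u0.
have qtr (M : 'M[R]_n) w : qform M^T w = qform M w.
  have E : w *m M^T *m w^T = (w *m M *m w^T)^T by rewrite !trmx_mul trmxK mulmxA.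
  by rewrite /qform E mxE.
have q0 (M : 'M[R]_n) : qform M 0 = 0 by rewrite /qform !mul0mx mxE.
have ImC (w : 'rV[R]_n) : map_mx (@complex.Im R) (toC w) = 0.
  by apply/rowP => j; rewrite !mxE.
have ReC (w : 'rV[R]_n) : map_mx (@complex.Re R) (toC w) = w.
  by apply/rowP => j; rewrite !mxE.
have uC0 : toC u != 0 by rewrite map_mx_eq0.
suff : (0 : R[i]) < hform (toC P) (toC u) (toC u).
  by rewrite ltcE Re_hform ImC ReC q0 addr0 => /andP[_].
apply: (@lyapunov_posdef _ n (toC A^T) (toC P) _ _ _ _ uC0).
- by move=> a /(hurwitz_tr Ah); rewrite -complexRe -(ltcR _ 0).
- by rewrite toC_trmxC Ps.
- move=> w w0; rewrite -complexRe -map_mxM (ltcR _ 0) Re_hform.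
  have tE : A^T *m P = (P *m A)^T by rewrite trmx_mul Ps.
  rewrite tE !qtr.
  have neg' z : qform (P *m A) z <= 0.
    by have [->|/neg/ltW //] := eqVneq z 0; rewrite q0.
  have [p0|p0] := eqVneq (map_mx (@complex.Re R) w) 0; last by rewrite ltr_wnDr ?neg.
  rewrite p0 q0 add0r neg //; apply: contra_neq w0 => i0.
  apply/rowP => j; rewrite mxE; apply/eqP; rewrite eq_complex /=.
  by move/rowP/(_ j): p0; move/rowP/(_ j): i0; rewrite !mxE => -> ->; rewrite !eqxx.
Qed.

End RealForms.

(** * A theorem of the alternative for semidefinite matrices *)

Section Alternative.
Local Open Scope classical_set_scope.
Variable R : realType.

Lemma linear_rV_continuous q (phi : 'rV[R]_q -> R) :
  (forall a u v, phi (a *: u + v) = a * phi u + phi v) -> continuous phi.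
Proof.
move=> lin; pose f : {linear 'rV[R]_q -> R^o} :=
  HB.pack (phi : _ -> R^o) (GRing.isLinear.Build _ _ _ _ (phi : _ -> R^o) lin).
have phiE : phi = (fun v => \sum_j v 0 j * f (delta_mx 0 j)).
  apply/funext => v.
  rewrite [phi v](_ : _ = f v) // {1}[v]row_sum_delta linear_sum.
  by apply: eq_bigr => j _; rewrite linearZ.
rewrite phiE; apply: continuous_big => [|j _ v]; first exact: add_continuous.
by apply: (@cvgM R _ (nbhs v)); [exact: coord_continuous|exact: cvg_cst].
Qed.

Definition psd1 N : set 'M[R]_N := [set Z | psd Z /\ \tr Z = 1].

(** The set is cut out by closed conditions on linear functions of the entries,
    and bounded since no entry exceeds the trace. *)
Lemma psd1_compact N : compact [set v : 'rV[R]_(N * N) | psd1 (vec_mx v)].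
Proof.
apply: bounded_closed_compact.
  exists 1; split; first exact: num_real.
  move=> x x1 v [vp vt]; rewrite /= [leLHS]/Num.Def.normr /= mx_normrE.
  apply: bigmax_le => [|[a l] _]; first exact: le_trans (ltW x1).
  apply: le_trans (ltW x1); rewrite /= ord1 -vt.
  have [[i j] <-] : exists p, (let: (i, j) := p in mxvec_index i j) = l.
    by case: (mxvec_indexP l) => i j; exists (i, j).
  by rewrite -{1}[v]vec_mxK mxvecE; apply: psd_entry_le.
set K := [set v | _].
have closed_lin (phi : 'rV[R]_(N * N) -> R) (A : set R) t :
    (forall a u v, phi (a *: u + v) = a * phi u + phi v) ->
    closed A -> (forall v, K v -> A (phi v)) -> closure K t -> A (phi t).
  move=> lin Ac KA Kt; apply: (preimage_closed _ Ac).
    by move=> v _; exact: linear_rV_continuous.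
  by apply: closureS Kt.
move=> t Kt; split; first split.
- apply/matrixP => i j; rewrite mxE; apply/eqP; rewrite -subr_eq0; apply/eqP.
  apply: (closed_lin (fun v => vec_mx v j i - vec_mx v i j) [set x | x = 0]) Kt.
  + by move=> a u v; rewrite !linearP /= !mxE; ring.
  + exact: closed_eq.
  + by move=> v [[vs _] _]; rewrite /= -{1}vs mxE subrr.
- move=> u.
  apply: (closed_lin (fun v => qform (vec_mx v) u) [set x | 0 <= x]) Kt.
  + move=> a v w; rewrite /qform !linearP /= mulmxDl -scalemxAl mxE.
    by congr (_ + _); rewrite mxE.
  + exact: closed_ge.
  + by move=> v [[_ vp] _]; exact: vp.
- apply: (closed_lin (fun v => \tr (vec_mx v)) [set x | x = 1]) Kt.
  + by move=> a v w; rewrite !linearP.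
  + exact: closed_eq.
  + by move=> v [].
Qed.

(** If the compact convex set [L (psd1 N)] avoids [0], its point [Y] of least norm
    satisfies [frob Y W >= frob Y Y] for every [W] in it; the conclusion
    is this inequality at the rank-one matrix [u^T u / (u u^T)]. *)
Lemma psd_alternative N p q (L : {linear 'M[R]_N -> 'M[R]_(p, q)}) :
  (forall Z, psd Z -> \tr Z = 1 -> L Z != 0) ->
  exists Y : 'M[R]_(p, q), exists2 d, 0 < d &
    forall u : 'rV[R]_N, d * (u *m u^T) 0 0 <= frob Y (L (u^T *m u)).
Proof.
move=> L0.
have norm (u : 'rV[R]_N) : u != 0 -> psd1 (((u *m u^T) 0 0)^-1 *: (u^T *m u)).
  move=> u0; split.
    by apply: psdZ; [rewrite invr_ge0 row_norm_ge0|exact: psd_outer].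
  by rewrite linearZ /= trace_outer mulVf // gt_eqF ?row_norm_gt0.
have [N0|N0] := posnP N.
  exists 0, 1 => // u; subst N.
  by rewrite thinmx0 mul0mx mxE mulr0 mulmx0 linear0 frobE mulmx0 linear0.
pose K := [set v : 'rV[R]_(N * N) | psd1 (vec_mx v)].
have Kne : K !=set0.
  pose u : 'rV[R]_N := delta_mx 0 (Ordinal N0).
  have u0 : u != 0.
    by apply/eqP => /matrixP/(_ 0 (Ordinal N0))/eqP; rewrite !mxE !eqxx oner_eq0.
  exists (mxvec (((u *m u^T) 0 0)^-1 *: (u^T *m u))).
  by rewrite /K /= mxvecK; apply: norm.
have fc : continuous (fun v : 'rV[R]_(N * N) =>
    frob (L (vec_mx v)) (L (vec_mx v))).
  apply: continuous_big => [|i _]; first exact: add_continuous.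
  apply: continuous_big => [|j _]; first exact: add_continuous.
  have c : continuous (fun v : 'rV[R]_(N * N) => L (vec_mx v) i j).
    by apply: linear_rV_continuous => a u v; rewrite !linearP /= !mxE.
  by move=> v; apply: (@cvgM R _ (nbhs v)); exact: c.
have [v0] := compact_EVT_min Kne (@psd1_compact N) (continuous_subspaceT fc).
rewrite inE => Kv0 vmin.
set Y := L (vec_mx v0) in vmin.
have Y0 : 0 < frob Y Y by apply: frob_gt0; case: Kv0 => *; apply: L0.
(* Moving from [Y] towards [L Z] would otherwise decrease the norm; [t] is
   small enough for that, and at most one. *)
have Ymin Z : psd1 Z -> frob Y Y <= frob Y (L Z).
  move=> [Zp Zt]; rewrite leNgt; apply/negP => lt.
  set W := L Z - Y.
  have a0 : frob Y W < 0.
    by rewrite frobC /W frobDl -scaleN1r frobZl mulN1r subr_lt0 frobC.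
  have b0 := frob_ge0 W.
  have [t tE] : exists t : R, t = - frob Y W / (frob W W - frob Y W) by eexists.
  have D0 : 0 < frob W W - frob Y W by rewrite subr_gt0 (lt_le_trans a0).
  have t0 : 0 <= t by rewrite tE divr_ge0 ?ltW // oppr_gt0.
  have t1 : 0 <= 1 - t by rewrite subr_ge0 tE ler_pdivrMr // mul1r lerDr.
  have [Vp Vt] := Kv0.
  have := vmin (mxvec ((1 - t) *: vec_mx v0 + t *: Z)).
  rewrite inE /K /= mxvecK => /(_ _)/wrap[].
    split; first by apply: psdD; apply: psdZ.
    by rewrite mxtraceD !mxtraceZ Vt Zt !mulr1 subrK.
  have -> : L ((1 - t) *: vec_mx v0 + t *: Z) = Y + t *: W.
    rewrite linearD !linearZ /= -/Y /W scalerBl scale1r scalerBr.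
    by rewrite -addrA [- _ + _]addrC.
  rewrite !frobDl !frobZl !(frobC _ (Y + _)) !frobDl !frobZl (frobC W Y).
  apply/negP; rewrite -ltNge.
  have -> : frob Y Y + t * frob Y W + t * (frob Y W + t * frob W W) =
     frob Y Y - (frob Y W) ^+ 2 * (frob W W - frob Y W *+ 2) /
       (frob W W - frob Y W) ^+ 2.
    by rewrite tE; field; rewrite gt_eqF.
  rewrite gtrDl oppr_lt0 divr_gt0 ?exprn_gt0 // mulr_gt0 //.
    by rewrite lt_def sqr_ge0 sqrf_eq0 lt_eqF.
  rewrite subr_gt0 (lt_le_trans _ b0) // mulr2n -oppr_gt0 opprD.
  by rewrite addr_gt0 // oppr_gt0.
exists Y, (frob Y Y) => // u.
have [->|u0] := eqVneq u 0.
  by rewrite mul0mx mxE mulr0 mulmx0 linear0 frobE mulmx0 linear0.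
have := Ymin _ (norm u u0); rewrite linearZ frobC frobZl.
by rewrite mulrC ler_pdivlMr ?row_norm_gt0 // frobC.
Qed.

End Alternative.

(** * Exponential decay along solutions *)

Section Decay.
Local Open Scope classical_set_scope.
Variable R : realType.

(** The function [V t * expR (k t)] is nonincreasing. *)
Lemma exp_decay (V dV : R -> R) (k : R) :
  {within `[0, +oo[, continuous V} ->
  (forall t : R, 0 < t -> is_derive t 1 V (dV t)) ->
  (forall t : R, 0 < t -> dV t <= - k * V t) ->
  forall t : R, 0 <= t -> V t <= expR (- k * t) * V 0.
Proof.
move=> Vc Vd Vle t t0.
pose E : R -> R := expR \o *%R k.
have Ed (s : R) : is_derive s 1 E (expR (k * s) * k).
  apply: is_derive1_comp.
  rewrite -[X in is_derive _ _ _ X]mulr1.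
  exact: (@is_deriveZ R R R id k s 1 1).
pose W : R -> R := V * E.
have Wd (s : R) : 0 < s -> is_derive s 1 W (V s *: (expR (k * s) * k) + E s *: dV s).
  by move=> s0; have := Vd s s0 => ?; exact: is_deriveM.
have := @ler0_derive1_nincry R W 0 _ _ _ 0 t (lexx 0) t0.
have -> : (W t <= W 0) = (V t <= expR (- k * t) * V 0).
  rewrite /W mulrfctE /E /= mulr0 expR0 mulr1 mulNr expRN mulrC.
  by rewrite [(expR _)^-1 * _]mulrC ler_pdivlMr ?expR_gt0 // mulrC.
apply.
- by move=> s; rewrite in_itv /= andbT => /Wd [].
- move=> s; rewrite in_itv /= andbT => s0; rewrite derive1E.
  have [_ ->] := Wd s s0.
  have := Vle s s0; rewrite /E /= /GRing.scale /= => h.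
  have -> : V s * (expR (k * s) * k) + expR (k * s) * dV s =
      expR (k * s) * (dV s - - k * V s) by ring.
  by rewrite pmulr_rle0 ?expR_gt0 // subr_le0.
- move=> s; apply: continuousM; first exact: Vc.
  have Ec : continuous E.
    move=> y; apply: continuous_comp; first exact: mulrl_continuous.
    exact: continuous_expR.
  exact: continuous_subspaceT.
Qed.

Lemma quad_sumE n (P : 'M[R]_n) (y z : 'cV[R]_n) :
  (y^T *m P *m z) 0 0 = \sum_i \sum_j P j i * (y j 0 * z i 0).
Proof.
rewrite mxE; apply: eq_bigr => i _; rewrite mxE mulr_suml.
by apply: eq_bigr => j _; rewrite mxE; ring.
Qed.

Lemma quad_continuous n (P : 'M[R]_n) :
  continuous (fun x : 'cV[R]_n => (x^T *m P *m x) 0 0).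
Proof.
under eq_fun do rewrite quad_sumE.
apply: continuous_big => [|i _]; first exact: add_continuous.
apply: continuous_big => [|j _ x]; first exact: add_continuous.
apply: (@cvgM R _ (nbhs x)); first exact: cvg_cst.
by apply: (@cvgM R _ (nbhs x)); exact: coord_continuous.
Qed.

Lemma quad_is_derive n (P : 'M[R]_n) (x : R -> 'cV[R]_n) (t : R) (dx : 'cV[R]_n) :
  P^T = P -> is_derive t 1 x dx ->
  is_derive t 1 (fun s => ((x s)^T *m P *m x s) 0 0)
    (((x t)^T *m P *m dx) 0 0 *+ 2).
Proof.
move=> Ps [xd xdE].
have xid i : is_derive t 1 (fun s => x s i 0) (dx i 0).
  apply: DeriveDef; first exact: (derivable_mxP _ _ _).1.
  by rewrite -xdE derive_mx // mxE.
have -> : (fun s => ((x s)^T *m P *m x s) 0 0) =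
    \sum_i \sum_j (P j i \*: ((fun s => x s j 0) * (fun s => x s i 0))).
  apply/funext => s; rewrite fct_sumE quad_sumE; apply: eq_bigr => i _.
  by rewrite fct_sumE; apply: eq_bigr => j _.
apply: is_derive_eq.
have sym : ((x t)^T *m P *m dx) 0 0 = (dx^T *m P *m x t) 0 0.
  have -> : (x t)^T *m P *m dx = (dx^T *m P *m x t)^T.
    by rewrite !trmx_mul trmxK Ps mulmxA.
  by rewrite mxE.
rewrite mulr2n {2}sym !quad_sumE -big_split; apply: eq_bigr => i _ /=.
rewrite -big_split; apply: eq_bigr => j _ /=.
by rewrite /GRing.scale /=; ring.
Qed.

Lemma euclidean_norm_sqr n (x : 'cV[R]_n) : euclidean_norm x ^+ 2 = (x^T *m x) 0 0.
Proof.
rewrite sqr_sqrtr; last by apply: sumr_ge0 => i _; rewrite sqr_ge0.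
by rewrite mxE; apply: eq_bigr => i _; rewrite mxE expr2.
Qed.

End Decay.

(** * The circle criterion *)

(** The system is [x' = A x + u b] with output [v x], under the feedback
    laws [u = 0] and [u = v x]. *)
Section CircleCriterion.
Variable R : realType.
Local Notation toC := (map_mx (real_complex R)).
Variables (n : nat) (A : 'M[R]_n) (b : 'cV[R]_n) (v : 'rV[R]_n).
Hypothesis A_hurwitz : hurwitz A.
Hypothesis Abv_hurwitz : hurwitz (A + b *m v).
Hypothesis no_neg_eig :
  forall l : R, l < 0 -> ~~ eigenvalue (A *m (A + b *m v)) l.

Lemma imaginary_not_eigenvalue (s : R) : ~~ eigenvalue (toC A) (Complex 0 s).
Proof. by apply/negP => /A_hurwitz /=; rewrite ltxx. Qed.

(** With [w = sqrt l], the matrix [l + A^2] factors as [(i w - A) (- i w - A)]. *)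
Lemma det_add_sqr_neq0 l : 0 <= l -> \det (l%:M + A *m A) != 0.
Proof.
move=> l0; pose w := Num.sqrt l.
have wh (s : R) : \det ((Complex 0 s)%:M - toC A) != 0.
  by rewrite det_eigenvalue imaginary_not_eigenvalue.
have E : toC (l%:M + A *m A) =
    ((Complex 0 w)%:M - toC A) *m ((Complex 0 (- w))%:M - toC A).
  rewrite map_mxD map_mxM map_scalar_mx mulmxBl !mulmxBr.
  rewrite -scalar_mxM mul_mx_scalar mul_scalar_mx opprB.
  have -> : Complex 0 (- w) = - Complex 0 w.
    by apply/eqP; rewrite eq_complex /= oppr0 !eqxx.
  rewrite scaleNr addrACA -opprD addrC subrr oppr0.
  rewrite add0r; congr (_%:M + _); apply/eqP; rewrite eq_complex /=.
  by rewrite -[X in X == _](sqr_sqrtr l0) -/w; apply/andP; split; apply/eqP; ring.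
rewrite -(fmorph_eq0 (real_complex R)) -det_map_mx E.
by rewrite det_mulmx mulf_neq0.
Qed.

Lemma det_add_mul_neq0 l : 0 <= l -> \det (l%:M + A *m (A + b *m v)) != 0.
Proof.
rewrite le_eqVlt => /orP[/eqP<-|l0].
  by rewrite raddf0 add0r det_mulmx mulf_neq0 // hurwitz_det_neq0.
have := @no_neg_eig (- l); rewrite oppr_lt0 l0 -det_eigenvalue => /(_ isT).
apply: contra_neq => h.
by rewrite raddfN -opprD -scaleN1r detZ h mulr0.
Qed.

(** Here [p + i q] is the response at frequency [w] to the unit input.
    Eliminating [q] gives [(w^2 + A^2) p = - A b], so that
    [w^2 + A (A + b v)] is [(w^2 + A^2) (1 - p v)]; compare determinants. *)
Lemma frequency_inequality_real (w : R) (p q : 'cV[R]_n) :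
  A *m p + b = - w *: q -> A *m q = w *: p -> (v *m p) 0 0 < 1.
Proof.
move=> hp hq.
have Np : ((w ^+ 2)%:M + A *m A) *m p = - (A *m b).
  rewrite mulmxDl mul_scalar_mx -mulmxA -[A *m p](addrK b) hp mulmxBr.
  by rewrite -scalemxAr hq scalerA addrA mulNr scaleNr expr2 subrr add0r.
have E : (w ^+ 2)%:M + A *m (A + b *m v) =
    ((w ^+ 2)%:M + A *m A) *m (1%:M - p *m v).
  by rewrite mulmxBr mulmx1 mulmxA Np mulNmx opprK mulmxDr addrA mulmxA.
have d1 := det_shift_gt0 det_add_sqr_neq0 (sqr_ge0 w).
have := det_shift_gt0 det_add_mul_neq0 (sqr_ge0 w).
by rewrite E det_mulmx pmulr_rgt0 // det_sub_rank_one subr_gt0.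
Qed.

(** The input [w] is nonzero since [l] is not an eigenvalue of [A]; dividing by it
    and taking real and imaginary parts leads to the real case. *)
Lemma frequency_inequality (l w : R[i]) (x : 'cV[R[i]]_n) : x != 0 -> 'Re l = 0 ->
  toC A *m x + w *: toC b = l *: x ->
  complex.Re (w^* * ((toC v *m x) 0 0 - w)) < 0.
Proof.
move=> x0 l0 h.
have {l0}[s lE] : exists s, l = Complex 0 s.
  case: l l0 {h} => a s; rewrite -complexRe /= => -[->]; by exists s.
have w0 : w != 0.
  apply: contra (imaginary_not_eigenvalue s) => /eqP w0.
  move: h; rewrite w0 scale0r addr0 lE => h.
  have: (x^T *m ((Complex 0 s)%:M - (toC A)^T)) == 0.
    by rewrite mulmxBr mul_mx_scalar -trmx_mul h linearZ subrr.
  have trE : ((Complex 0 s)%:M - toC A)^T = (Complex 0 s)%:M - (toC A)^T.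
    by rewrite linearB /= tr_scalar_mx.
  rewrite -det_eigenvalue -det_tr trE => /eqP xs.
  by apply/det0P; exists x^T => //; rewrite trmx_eq0.
pose x' := w^-1 *: x.
have xE : x = w *: x' by rewrite /x' scalerA divff // scale1r.
have h' : toC A *m x' + toC b = Complex 0 s *: x'.
  rewrite /x' -scalemxAr scalerA mulrC -scalerA -lE -h scalerDr scalerA.
  by rewrite mulVf // scale1r.
have hRe : A *m map_mx (@complex.Re R) x' + b =
    - s *: map_mx (@complex.Im R) x'.
  rewrite -map_Re_mul; apply/matrixP => i j.
  have := congr1 (fun M : 'cV_n => complex.Re (M i j)) h'.
  rewrite !mxE raddfD /= => ->.
  by case: (w^-1 * x i j) => a c /=; rewrite mul0r sub0r mulNr.
have hIm : A *m map_mx (@complex.Im R) x' = s *: map_mx (@complex.Re R) x'.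
  rewrite -map_Im_mul; apply/matrixP => i j.
  have := congr1 (fun M : 'cV_n => complex.Im (M i j)) h'.
  rewrite !mxE raddfD /= addr0 => ->.
  by case: (w^-1 * x i j) => a c /=; rewrite mul0r add0r.
have := frequency_inequality_real hRe hIm; rewrite -map_Re_mul mxE => y1.
by rewrite xE -scalemxAr mxE Re_conj_mul_lt0.
Qed.

(** Writing [f = X k^T], the feedback [u = k x] turns the equation into the
    skewness of [(A + b k) X]; the frequency inequality is then summed over the
    resulting decomposition of [X].  This shows that the constraints dual to
    those on the Lyapunov matrix cannot be met. *)
Lemma kyp_dual (X : 'M[R]_n) (f : 'cV[R]_n) (w : R) :
  psd (block_mx X f f^T w%:M) -> 0 < \tr X + w ->
  (A *m X + b *m f^T) + (A *m X + b *m f^T)^T = 0 ->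
  (v *m f) 0 0 - w < 0.
Proof.
move=> Zpsd Ztr Zeq.
have Xpsd := block_psd_ul Zpsd; have [Xs Xp] := Xpsd.
have [k fk] := block_psd_range Zpsd.
have wk := block_psd_schur Zpsd fk.
pose Ak := A + b *m k.
have AkX : Ak *m X = A *m X + b *m f^T by rewrite mulmxDl fk mulmxA.
have [|||s sE sP] := @psd_skew_eigenvectors _ n (toC X) (toC Ak^T).
- by rewrite toC_trmxC Xs.
- by move=> u; apply: psd_toC.
- rewrite toC_trmxC trmxK -!map_mxM -map_mxD.
  by rewrite addrC -{2}Xs -trmx_mul AkX Zeq map_mx0.
have key x : x \in s ->
    complex.Re ((toC k *m x^t* *m x *m toC (v - k)^T) 0 0) < 0.
  case/sP => x0 [l l0 xl].
  have := @frequency_inequality l ((toC k *m x^T) 0 0) x^T _ l0 _.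
  rewrite trmx_eq0 x0 => /(_ isT) h.
  have /h {h} : toC A *m x^T + (toC k *m x^T) 0 0 *: toC b = l *: x^T.
    rewrite -linearZ -xl /= trmx_mul map_trmx trmxK map_mxD map_mxM mulmxDl.
    by rewrite -mulmxA [toC k *m x^T in RHS]mx11_scalar mul_mx_scalar.
  congr (complex.Re _ < 0).
  rewrite -[in RHS]mulmxA [toC k *m x^t*]mx11_scalar mul_scalar_mx [RHS]mxE.
  congr (_ * _).
    rewrite !mxE rmorph_sum; apply: eq_bigr => i _.
    rewrite !mxE rmorphM; congr (_ * _); apply/eqP.
    by rewrite eq_complex /= oppr0 !eqxx.
  have -> : x *m toC (v - k)^T = (toC (v - k) *m x^T)^T.
    by rewrite trmx_mul trmxK map_trmx.
  by rewrite [RHS]mxE map_mxB mulmxBl [RHS]mxE; congr (_ + _); rewrite [RHS]mxE.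
have vf : (v *m f) 0 0 - qform X k =
    complex.Re (\sum_(x <- s) (toC k *m x^t* *m x *m toC (v - k)^T) 0 0).
  have -> : \sum_(x <- s) (toC k *m x^t* *m x *m toC (v - k)^T) 0 0 =
      (toC (k *m X *m (v - k)^T)) 0 0.
    rewrite !map_mxM sE mulmx_sumr mulmx_suml summxE.
    by apply: eq_bigr => x _; rewrite !mulmxA.
  have -> : qform X k = (k *m f) 0 0 by rewrite /qform -fk -trmx_mul mxE.
  rewrite -fk -trmx_mul mulmxBl [(toC _) 0 0]mxE /= [RHS]mxE [RHS]mxE.
  by congr (_ + _); rewrite [RHS]mxE.
case: s sE sP key vf => [|x s] sE sP key vf.
  move: sE vf; rewrite !big_nil => /eqP.
  rewrite map_mx_eq0 => /eqP X0 _.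
  move: Ztr; rewrite X0 raddf0 add0r => w0.
  by rewrite -[f]trmxK fk X0 mulmx0 trmx0 mulmx0 mxE sub0r oppr_lt0.
have : (v *m f) 0 0 - qform X k < 0.
  rewrite vf raddf_sum big_cons ltr_wnDr ?key ?mem_head //.
  rewrite big_seq sumr_le0 // => y ys; apply/ltW/key.
  by rewrite inE ys orbT.
by lra.
Qed.

Definition kypE (Z : 'M[R]_(n + 1)) : 'M[R]_n :=
  A *m ulsubmx Z + b *m dlsubmx Z.
(** The adjoint of the map taking a Lyapunov matrix and the multiplier of the
    sector condition to the quadratic form that has to be definite. *)
Definition kypL (Z : 'M[R]_(n + 1)) : 'M[R]_(n + 1) :=
  block_mx (kypE Z + (kypE Z)^T) 0 0 (v *m (dlsubmx Z)^T - drsubmx Z).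

Lemma submx_linear a (Y Z : 'M[R]_(n + 1)) :
  (ulsubmx (a *: Y + Z) = a *: ulsubmx Y + ulsubmx Z) *
  (dlsubmx (a *: Y + Z) = a *: dlsubmx Y + dlsubmx Z) *
  (drsubmx (a *: Y + Z) = a *: drsubmx Y + drsubmx Z).
Proof. by do !split; apply/matrixP => i j; rewrite !mxE. Qed.

Lemma kypE_linear : linear kypE.
Proof.
move=> a Y Z; rewrite /kypE !submx_linear !mulmxDr -!scalemxAr scalerDr.
by rewrite addrACA.
Qed.

Lemma kypL_linear : linear kypL.
Proof.
move=> a Y Z; rewrite /kypL kypE_linear !submx_linear scale_block_mx add_block_mx.
rewrite !scaler0 !addr0; congr block_mx.
  by rewrite linearP /= [in RHS]scalerDr addrACA.
by rewrite linearP /= mulmxDr -scalemxAr [in RHS]scalerBr opprD addrACA.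
Qed.

HB.instance Definition _ := GRing.isLinear.Build _ _ _ _ kypL kypL_linear.

Lemma kypL_neq0 Z : psd Z -> \tr Z = 1 -> kypL Z != 0.
Proof.
move=> Zp Zt; apply/eqP.
rewrite /kypL -[0 in RHS](@block_mx_const R n 1 n 1 0) => /eq_block_mx[E0 _ _ s0].
have ZE : Z = block_mx (ulsubmx Z) (dlsubmx Z)^T (dlsubmx Z)^T^T
    ((drsubmx Z) 0 0)%:M.
  by rewrite trmxK -mx11_scalar trmx_dlsub Zp.1 submxK.
have := @kyp_dual (ulsubmx Z) (dlsubmx Z)^T ((drsubmx Z) 0 0).
rewrite -ZE trmxK => /(_ Zp); rewrite -[A *m _ + _]/(kypE Z) E0.
have -> : \tr (ulsubmx Z) + (drsubmx Z) 0 0 = 1.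
  by rewrite -Zt [in RHS]ZE mxtrace_block mxtrace_scalar.
move=> /(_ ltr01 erefl); move/matrixP/(_ 0 0): s0.
rewrite mxE [X in _ + X]mxE => ->.
by rewrite mxE ltxx.
Qed.

(** The separating functional provided by the alternative is a block matrix
    [Y]: its upper left block gives, up to sign and symmetrization, the
    Lyapunov matrix, and its lower right entry the multiplier [y] of the
    sector condition.  That [y] is negative is
    seen at [x = 0], [s = 1]. *)
Lemma strict_kyp : exists P : 'M[R]_n, exists2 d, P^T = P /\ 0 < d &
  forall (x : 'cV[R]_n) s, 0 <= s * ((v *m x) 0 0 - s) ->
    (x^T *m P *m (A *m x + s *: b)) 0 0 <= - d * (x^T *m x) 0 0.
Proof.
have [Y [d d0 Yd]] := psd_alternative kypL_neq0.
pose S := ulsubmx Y + (ulsubmx Y)^T; set y := (drsubmx Y) 0 0.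
have key (x : 'cV[R]_n) s :
    d * ((x^T *m x) 0 0 + s ^+ 2) <=
    (x^T *m S *m (A *m x + s *: b)) 0 0 + y * (s * ((v *m x) 0 0 - s)).
  have := Yd (row_mx x^T s%:M); set z := row_mx _ _.
  have -> : (z *m z^T) 0 0 = (x^T *m x) 0 0 + s ^+ 2.
    rewrite /z tr_row_mx mul_row_col trmxK tr_scalar_mx -scalar_mxM mxE.
    by rewrite [X in _ + X]mxE eqxx mulr1n expr2.
  have -> : z^T *m z = block_mx (x *m x^T) (s *: x) (s *: x^T) (s ^+ 2)%:M.
    rewrite /z tr_row_mx mul_col_row trmxK tr_scalar_mx -scalar_mxM expr2.
    by rewrite mul_mx_scalar mul_scalar_mx.
  set xd := A *m x + s *: b.
  rewrite frobE -[Y in \tr (Y^T *m _)]submxK tr_block_mx /= /kypL /kypE.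
  rewrite block_mxKul block_mxKdl block_mxKdr.
  have -> : A *m (x *m x^T) + b *m (s *: x^T) = xd *m x^T.
    by rewrite /xd mulmxDl -scalemxAl -scalemxAr mulmxA.
  rewrite mulmx_block mxtrace_block !mulmx0 addr0 add0r (mulmxDr (ulsubmx Y)^T) mxtraceD.
  have -> : \tr ((ulsubmx Y)^T *m (xd *m x^T)) = (x^T *m (ulsubmx Y)^T *m xd) 0 0.
    by rewrite mulmxA mxtrace_mulC mulmxA trace_mx11.
  have -> : \tr ((ulsubmx Y)^T *m (xd *m x^T)^T) = (x^T *m ulsubmx Y *m xd) 0 0.
    rewrite -mxtrace_tr trmx_mul !trmxK mxtrace_mulC mulmxA mxtrace_mulC.
    by rewrite mulmxA trace_mx11.
  have -> : \tr ((drsubmx Y)^T *m (v *m (s *: x^T)^T - (s ^+ 2)%:M)) =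
      y * (s * ((v *m x) 0 0 - s)).
    rewrite trace_mx11 linearZ /= trmxK -scalemxAr mxE big_ord1 mxE -/y.
    by rewrite !mxE eqxx mulr1n expr2; congr (_ * _); rewrite mulrBr.
  rewrite /S (mulmxDr x^T) (mulmxDl _ _ xd) [X in _ -> _ <= X + _]mxE.
  by rewrite [X in _ -> _ <= X + _]addrC.
exists (- S), d.
  by split => //; rewrite linearN /= /S linearD /= trmxK addrC.
have y0 : y < 0.
  have := key 0 1; rewrite !trmx0 !mul0mx !mulmx0 !mxE; lra.
move=> x s xs; have := key x s.
have := mulr_le0_ge0 (ltW y0) xs.
have -> z : (x^T *m - S *m z) 0 0 = - (x^T *m S *m z) 0 0.
  by rewrite mulmxN mulNmx mxE.
have := mulr_ge0 (ltW d0) (sqr_ge0 s).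
clear; lra.
Qed.

(** Since the Lyapunov inequality is strict, it persists for [P - m] with a small
    [m > 0]; the positivity of that matrix is the lower bound on [P]. *)
Lemma quadratic_lyapunov : exists P : 'M[R]_n, exists m M d : R,
  [/\ P^T = P, 0 < m, 0 < M & 0 < d] /\
  (forall x : 'cV_n,
    m * (x^T *m x) 0 0 <= (x^T *m P *m x) 0 0 <= M * (x^T *m x) 0 0) /\
  forall (x : 'cV_n) s, 0 <= s * ((v *m x) 0 0 - s) ->
    (x^T *m P *m (A *m x + s *: b)) 0 0 <= - d * (x^T *m x) 0 0.
Proof.
have [P [d [Ps d0] Pd]] := strict_kyp.
have [M M0 PM] := qform_bound P.
have [c c0 Ac] := qform_bound A.
pose m := d / (2 * c).
have m0 : 0 < m by rewrite divr_gt0 // mulr_gt0.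
have Pm : forall u : 'rV_n, u != 0 -> 0 < qform (P - m%:M) u.
  apply: (hurwitz_lyapunov_posdef A_hurwitz); first by rewrite linearB /= tr_scalar_mx Ps.
  move=> u u0; have := Pd u^T 0; rewrite mul0r scale0r addr0 trmxK => /(_ (lexx _)) h.
  have -> : qform ((P - m%:M) *m A) u =
      (u *m P *m (A *m u^T)) 0 0 - m * qform A u.
    rewrite /qform mulmxBl mulmxBr mulmxBl mul_scalar_mx.
    rewrite -scalemxAr -scalemxAl !mulmxA.
    by rewrite mxE; congr (_ + _); rewrite !mxE.
  have h2 : - (m * qform A u) <= d / 2 * (u *m u^T) 0 0.
    have -> : d / 2 = m * c by rewrite /m; field; rewrite gt_eqF.
    rewrite -mulrN -mulrA ler_wpM2l ?(ltW m0) //.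
    by apply: le_trans (Ac u); rewrite -normrN ler_norm.
  have := mulr_gt0 d0 (row_norm_gt0 u0).
  move: h h2; clear; lra.
exists P, m, M, d; split => //; split => // x.
have := PM x^T; rewrite /qform trmxK => h.
rewrite (le_trans (ler_norm _) h) andbT.
have [->|x0] := eqVneq x^T 0; first by rewrite !mul0mx mxE mulr0.
have := Pm _ x0; rewrite /qform trmxK mulmxBr mulmxBl mul_mx_scalar -scalemxAl.
by rewrite mxE [X in _ + X]mxE [X in _ - X]mxE subr_gt0 => /ltW.
Qed.

(** The Lyapunov function [x^T P x] decays at rate [2 d / M], hence the norm at
    rate [d / M]. *)
Theorem sector_feedback_GES (psi : 'cV[R]_n -> R) :
  (forall x, 0 <= psi x * ((v *m x) 0 0 - psi x)) ->
  globally_exponentially_stable (fun x => A *m x + psi x *: b).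
Proof.
move=> sector.
have [P [m [M [d [[Ps m0 M0 d0] [Pb Pd]]]]]] := quadratic_lyapunov.
exists (Num.sqrt (M / m)), (d / M); split; rewrite ?sqrtr_gt0 ?divr_gt0 //.
move=> x [xc xd] t t0.
pose V s := ((x s)^T *m P *m x s) 0 0.
have := @exp_decay R V
  (fun s => ((x s)^T *m P *m (A *m x s + psi (x s) *: b)) 0 0 *+ 2)
  (2 * (d / M)) _ _ _ t t0.
move=> /(_ _ _ _)/wrap[].
- apply: (@within_continuous_comp _ _ _ _ x (fun y => (y^T *m P *m y) 0 0)) => //.
  by move=> y _; exact: quad_continuous.
- by move=> s s0; apply: quad_is_derive => //; exact: xd.
- move=> s s0; have := Pd (x s) _ (sector (x s)).
  have /andP[_ h1] := Pb (x s) => h2.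
  have h3 : d / M * V s <= d * ((x s)^T *m x s) 0 0.
    by rewrite mulrAC ler_pdivrMr // -mulrA ler_wpM2l ?(ltW d0) // mulrC.
  rewrite mulNr -mulrA; move: h2 h3; clear; lra.
move=> Vt.
have en0 y : 0 <= euclidean_norm y by exact: sqrtr_ge0.
rewrite -(@ler_pXn2r _ 2) ?nnegrE ?mulr_ge0 ?en0 ?sqrtr_ge0 ?expR_ge0 //.
rewrite !exprMn !euclidean_norm_sqr sqr_sqrtr ?(divr_ge0 (ltW M0) (ltW m0)) //.
have -> : expR (- (d / M) * t) ^+ 2 = expR (- (2 * (d / M)) * t).
  by rewrite expr2 -expRD; congr expR; ring.
have /andP[h1 _] := Pb (x t); have /andP[_ h2] := Pb (x 0).
rewrite -(ler_pM2l m0).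
apply: (le_trans h1); apply: (le_trans Vt).
set e := expR _.
have -> : m * (M / m * e * ((x 0)^T *m x 0) 0 0) =
    e * (M * ((x 0)^T *m x 0) 0 0).
  by field; rewrite gt_eqF.
by rewrite ler_wpM2l // expR_ge0.
Qed.

End CircleCriterion.

Theorem theorem6 (R : realType) (n m : nat)
    (A : 'M[R]_n.+1) (B : 'M[R]_(n.+1, m)) (c : 'cV[R]_n.+1) (d : R)
    (r : nat) (alpha : 'I_r -> R) (G : 'M[R]_m) (K : 'M[R]_(m, n.+1))
    (stabAB : stabilizable A B)
    (d_gt0 : 0 < d)
    (rel_deg : has_relative_degree A B c r)
    (alpha_gt0 : forall j, 0 < alpha j)
    (Gpos : sym_posdef G)
    (A0_hurwitz : hurwitz (A0 A B K))
    (Atilde_hurwitz : hurwitz (Atilde A B c alpha G K))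
    (no_neg_eig : forall l : R, l < 0 ->
       ~~ eigenvalue (A0 A B K *m Atilde A B c alpha G K) l) :
  globally_exponentially_stable (closed_loop A B c d alpha G K).
Proof.
pose eta_ := Defs.eta A B c d alpha K.
have k0 : 0 < (\prod_(j < r) alpha j) * d by rewrite mulr_gt0 // prodr_gt0.
have -> : closed_loop A B c d alpha G K =
    (fun x => A0 A B K *m x + Num.min (eta_ x) 0 *: v1 A B c r G).
  apply/funext => x; rewrite /closed_loop -/eta_.
  have [e0|e0] := leP 0 (eta_ x); first by rewrite scale0r addr0.
  rewrite /Atilde mulmxDl -addrA; congr (_ + _).
  rewrite /btilde -mulmxA [v2T A B c alpha K *m x]mx11_scalar mul_mx_scalar.
  by rewrite -scalerDl.
(* The sector condition: when [eta] is negative, [y - w] is minus the product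
   of [d] and of all the [alpha j]. *)
apply: (sector_feedback_GES A0_hurwitz Atilde_hurwitz no_neg_eig) => x.
have [e0|e0] := leP 0 (eta_ x); first by rewrite mul0r.
by rewrite nmulr_rge0 // /eta_ /Defs.eta opprD addrA subrr sub0r oppr_le0 ltW.
Qed.
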